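(* Let $B_1,\dots,B_p$ be real $d\times d$ matrices with $B_i^T+B_i\le 0$ for $i=1,\dots,p$. Assume that $\bigcap_{i=1}^p\mathcal{V}_i=\{0\}$. Then, for every regular input $u$, the matrix $S_u$ is equal to $0$ and the switched system $\dot x=B_{u(t)}x$ is asymptotically stable, as soon as one of the following conditions holds: 1. there exists $i$ such that $\dim\mathcal{V}_i=0$; 2. there exists $i$ such that $\dim\mathcal{V}_i=1$ and $\mathcal{V}_i\nsubseteq\mathcal{V}_j$ for all $j\ne i$; 3. $p=2$; 4. $p>2$, but $\dim\big(\sum_{i=1}^p\mathcal{V}_i\big)>\sum_{i=1}^p\dim(\mathcal{V}_i)-p+1$. In particular in the plane, that is for $d=2$, at least one of these conditions is satisfied as soon as $\mathcal{V}_i\ne\mathbb{R}^2$ for $i=1,\dots,p$.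
   Context: For a symmetric matrix $Q$, $Q\le 0$ means $x^TQx\le 0$ for all $x\in\mathbb{R}^d$; $\|\cdot\|$ is the Euclidean norm on $\mathbb{R}^d$. For each $i$, $\mathcal{V}_i=\{x\in\mathbb{R}^d;\ \forall t\in\mathbb{R},\ \|e^{tB_i}x\|=\|x\|\}$, a linear subspace. An input (switching signal) is a piecewise constant, right-continuous function $u:[0,+\infty[\to\{1,\dots,p\}$, with switching times $(a_n)_{n\ge0}$, $a_0=0$, strictly increasing to $+\infty$; $u$ is constant, equal to $u_n$, on $[a_n,a_{n+1}[$, and $\delta_n=a_{n+1}-a_n$. The solution of $\dot x=B_{u(t)}x$ from $x$ is $t\mapsto\Phi_u(t)x$, where $\Phi_u(t)=\exp((t-a_n)B_{u_n})\exp(\delta_{n-1}B_{u_{n-1}})\cdots\exp(\delta_0B_{u_0})$ for $t\in[a_n,a_{n+1}[$. The matrix $\Phi_u(t)^T\Phi_u(t)$ converges as $t\to+\infty$, and $S_u$ denotes the symmetric nonnegative square root of its limit. The system is asymptotically stable for $u$ if $\Phi_u(t)x\to0$ as $t\to+\infty$ for every $x\in\mathbb{R}^d$. The input $u$ is chaotic if there exist $\tau>0$ and a sequence of intervals $[t_k,t_k+\tau]$, $k\ge0$, with $t_k\to+\infty$, such that for all $\epsilon>0$ there exists $k_0$ such that for all $k\ge k_0$ the input $u$ is constant on no subinterval of $[t_k,t_k+\tau]$ of length greater than or equal to $\epsilon$. Otherwise $u$ is non chaotic. The input $u$ satisfies assumption $H(i)$ if there exist a subsequence $(a_{n_k})_{k\ge0}$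 of the switching times and $\delta>0$ such that $u_{n_k}=i$ and $\delta_{n_k}\ge\delta$ for all $k\ge0$. The input $u$ is regular if it is non chaotic and satisfies $H(i)$ for every $i=1,\dots,p$. *)

(* Defs.v *)
From mathcomp Require Import all_boot all_order all_algebra.
From mathcomp Require Import all_classical all_reals all_analysis.

Set Implicit Arguments.
Unset Strict Implicit.
Unset Printing Implicit Defensive.

Import Order.TTheory GRing.Theory Num.Theory.
Import numFieldNormedType.Exports.

Local Open Scope classical_set_scope.
Local Open Scope ring_scope.

Section LinearSpan.
Variables (K : fieldType) (vT : vectType K).

Fact vspan_subproof (A : set vT) : exists U : {vspace vT},
  A `<=` [set` U] /\ forall W : {vspace vT}, A `<=` [set` W] -> (U <= W)%VS.
Proof.
pose P n := `[< exists U : {vspace vT}, A `<=` [set` U] /\ \dim U = n >].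
have exP : exists n, P n.
  exists (\dim {:vT}); apply/asboolP; exists fullv; split=> // x _ /=.
  exact: memvf.
case: (ex_minnP exP) => n /asboolP[U [AU dimU]] minn.
exists U; split=> // W AW; rewrite -dimU in minn.
suff -> : U = (U :&: W)%VS by exact: capvSr.
apply/eqP; rewrite eq_sym eqEdim capvSl /=; apply: minn; apply/asboolP.
exists (U :&: W)%VS; split=> // x Ax /=; rewrite memv_cap; apply/andP.
by split; [exact: AU | exact: AW].
Qed.

(* The smallest subspace containing [A]; when [A] is itself a linear subspace
   it is [A], packaged as a {vspace _} (see [vspan_submod]). *)
Definition vspan (A : set vT) : {vspace vT} := sval (cid (vspan_subproof A)).

Lemma sub_vspan (A : set vT) : A `<=` [set` vspan A].
Proof. by case: (svalP (cid (vspan_subproof A))). Qed.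

Lemma vspan_min (A : set vT) (W : {vspace vT}) :
  A `<=` [set` W] -> (vspan A <= W)%VS.
Proof. by case: (svalP (cid (vspan_subproof A))) => _; apply. Qed.

Lemma vspan_submod (A : set vT) :
  A 0 -> (forall (a : K) x y, A x -> A y -> A (a *: x + y)) ->
  [set` vspan A] = A.
Proof.
move=> A0 Alin.
pose P n := `[< exists U : {vspace vT}, [set` U] `<=` A /\ \dim U = n >].
have exP : exists n, P n.
  exists 0; apply/asboolP; exists 0%VS; split; last exact: dimv0.
  by move=> x /=; rewrite memv0 => /eqP ->.
have ubP n : P n -> (n <= \dim {:vT})%N.
  by move=> /asboolP[U [_ <-]]; exact: dimvS (subvf U).
case: (ex_maxnP exP ubP) => n /asboolP[U [UA dimU]] maxn.
have AU : A `<=` [set` U].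
  move=> x Ax /=; have sU : (U <= U + <[x]>)%VS by exact: addvSl.
  suff /eqP -> : U == (U + <[x]>)%VS by rewrite (subvP (addvSr _ _)) ?memv_line.
  rewrite eqEdim sU dimU; apply: maxn; apply/asboolP.
  exists (U + <[x]>)%VS; split=> // y /memv_addP[v vU [w /vlineP[k ->] ->]].
  by rewrite addrC; apply: Alin => //; exact: UA.
apply/seteqP; split; last exact: sub_vspan.
by move=> x /= /(subvP (vspan_min AU)) /UA.
Qed.

End LinearSpan.

Section LinearSwitchedSystem.
Variables (R : realType) (d p : nat).

Definition expmx (A : 'M[R]_d) : 'M[R]_d :=
  limn (series (fun n => n`!%:R^-1 *: A ^+ n)).

(* The library norm `|x| on matrices is the sup norm. *)
Definition eucl_norm (x : 'cV[R]_d) : R := Num.sqrt (\sum_i x i 0 ^+ 2).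

Definition psd (Q : 'M[R]_d) : Prop :=
  forall x : 'cV[R]_d, 0 <= (x^T *m Q *m x) 0 0.

Definition nsd (Q : 'M[R]_d) : Prop :=
  forall x : 'cV[R]_d, (x^T *m Q *m x) 0 0 <= 0.

Definition isometric_set (A : 'M[R]_d) : set 'cV[R]_d :=
  [set x | forall t : R, eucl_norm (expmx (t *: A) *m x) = eucl_norm x].

(* Values of the input at negative times are irrelevant. Consecutive modes
   [u (swt u n)] and [u (swt u n.+1)] are not required to be distinct, so that
   inputs with finitely many actual jumps are covered. *)
Record input := Input {
  input_fun :> R -> 'I_p;
  swt : nat -> R;
  swt0 : swt 0 = 0;
  swt_incr : {homo swt : m n / (m < n)%N >-> m < n};
  swt_cvgy : swt n @[n --> \oo] --> +oo;
  input_const : forall n t, swt n <= t < swt n.+1 ->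
    input_fun t = input_fun (swt n) }.

Definition mode (u : input) (n : nat) : 'I_p := u (swt u n).

Definition dwell (u : input) (n : nat) : R := swt u n.+1 - swt u n.

Definition chaotic (u : input) : Prop :=
  exists tau : R, 0 < tau /\ exists t : nat -> R,
    [/\ forall k, 0 <= t k, t k @[k --> \oo] --> +oo &
     forall eps : R, 0 < eps -> exists k0 : nat, forall k, (k0 <= k)%N ->
       forall b c : R, t k <= b -> c <= t k + tau -> eps <= c - b ->
         ~ (forall s s', s \in `[b, c] -> s' \in `[b, c] -> u s = u s')].

Definition hypH (u : input) (i : 'I_p) : Prop :=
  exists n : nat -> nat, {homo n : k l / (k < l)%N} /\
    exists delta : R, 0 < delta /\
      forall k, mode u (n k) = i /\ delta <= dwell u (n k).

Definition regular (u : input) : Prop := ~ chaotic u /\ forall i, hypH u i.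

Variable B : 'I_p -> 'M[R]_d.

Fixpoint Phi_swt (u : input) (n : nat) : 'M[R]_d :=
  if n is m.+1 then expmx (dwell u m *: B (mode u m)) *m Phi_swt u m
  else 1%:M.

Definition Phi (u : input) (t : R) : 'M[R]_d :=
  (* for 0 <= t, the unique n with t in [a_n, a_(n+1)[ *)
  let n := xget 0%N [set n | swt u n <= t < swt u n.+1] in
  expmx ((t - swt u n) *: B (mode u n)) *m Phi_swt u n.

(* The symmetric nonnegative square root of the limit of Phi^T Phi. The default
   value of [xget] is nonzero (for 0 < d), so [Slim u = 0] does entail that the
   limit exists and is zero. *)
Definition Slim (u : input) : 'M[R]_d :=
  xget 1%:M [set S : 'M[R]_d | [/\ S^T = S, psd S &
    (Phi u t)^T *m Phi u t @[t --> +oo] --> S *m S]].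

Definition asymptotically_stable (u : input) : Prop :=
  forall x : 'cV[R]_d, Phi u t *m x @[t --> +oo] --> (0 : 'cV[R]_d).

Definition Vset (i : 'I_p) : set 'cV[R]_d := isometric_set (B i).

(* Under B_i^T + B_i <= 0 the set [Vset i] is a linear subspace, hence equal
   to [Vsp i]. *)
Definition Vsp (i : 'I_p) : {vspace 'cV[R]_d} := vspan (Vset i).

Definition dim_condition : Prop :=
  [\/ exists i, \dim (Vsp i) = 0%N,
      exists i, \dim (Vsp i) = 1%N /\
        forall j, j != i -> ~ (Vset i `<=` Vset j),
      p = 2%N |
      (2 < p)%N /\
      (\sum_i (\dim (Vsp i))%:Z - p%:Z + 1 < (\dim (\sum_i Vsp i)%VS)%:Z)%R].

End LinearSwitchedSystem.

(* Main.v *)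
Require Import Defs.
From mathcomp Require Import all_boot all_order all_algebra.
From mathcomp Require Import all_classical all_reals all_analysis.
From mathcomp Require Import ring lra zify.
Import Order.TTheory GRing.Theory Num.Theory.
Import numFieldNormedType.Exports.
Local Open Scope classical_set_scope.
Local Open Scope ring_scope.
Set Implicit Arguments.
Unset Strict Implicit.
Unset Printing Implicit Defensive.

(** Fix a regular input and a trajectory y(t) = Phi(t) x. Dissipativity makes
    |y(t)|^2 nonincreasing, hence convergent to some r >= 0, and stability is
    the assertion r = 0 for every x. Suppose r > 0; every limit point of y at
    infinity then lies on the sphere |w|^2 = r.

    The analytic tool is the energy loss |v|^2 - |exp(sB_i)v|^2 for s > 0. It is
    continuous and nonnegative, and it vanishes exactly on the isometric
    subspace V_i ([energy_loss0_isometric]): if the norm is constant on [0, s],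
    then Q = B_i^T + B_i kills exp(tB_i)v on ]0, s[, so do all Q B_i^k by
    repeated differentiation, and the exponential series propagates this to
    every t. Along the trajectory the energy loss over a time interval on which
    mode i is active tends to 0, because |y|^2 converges. Hence a limit point of
    y along times at which mode i stays active for a fixed duration lies in V_i
    ([frequently_mode_limit]). This has two consequences. Assumption H(i) gives
    a limit point in V_i for each i ([hypH_limit]). If u is not chaotic, every
    limit point w lies in some V_i ([limit_pt_isometric]): a short window after
    each time at which y is close to w contains an interval of constancy of u
    of length bounded below, and y moves little during the window, so some V_i
    meets every neighbourhood of w.

    The limit set is thus covered by the V_i and meets each of them away from 0.
    The trajectory is continuous and bounded, so the limit set cannot be split
    into two separated parts: for every partition of the modes into two nonempty
    classes, some V_i of the first class and some V_j of the second share a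
    nonzero vector ([limit_set_connected]). In other words the graph joining i
    to j when V_i and V_j overlap is connected.

    Each of the four conditions is incompatible with this
    ([dim_condition_separates]). For the fourth one, adding the subspaces one at
    a time in an order in which each overlaps the sum of the previous ones loses
    at least one dimension at each of the p - 1 steps
    ([overlap_connected_dim_sum]). Finally r = 0 for all x gives Phi(t) -> 0,
    hence S_u = 0. *)

(** * Matrix-valued limits and derivatives, and the matrix exponential *)

Section MatrixAnalysis.
Context {R : realType}.

Lemma mx_entry_le m n (A : 'M[R]_(m, n)) i j : `|A i j| <= `|A|.
Proof.
by rewrite [leRHS]/Num.norm /= mx_normrE; apply: (le_bigmax _ _ (i, j)).
Qed.

Lemma mx_norm_le m n (A : 'M[R]_(m, n)) c :
  0 <= c -> (forall i j, `|A i j| <= c) -> `|A| <= c.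
Proof.
move=> c0 Ac; rewrite [leLHS]/Num.norm /= mx_normrE.
by apply/bigmax_leP; split => // -[i j] _; exact: Ac.
Qed.

Lemma mulmx_entry_le m n q (A : 'M[R]_(m, n)) (B : 'M[R]_(n, q)) i j :
  `|(A *m B) i j| <= n%:R * (`|A| * `|B|).
Proof.
rewrite mxE (le_trans (ler_norm_sum _ _ _))//.
rewrite -[n in n%:R]card_ord mulr_natl -sumr_const ler_sum// => k _.
by rewrite normrM ler_pM// mx_entry_le.
Qed.

Lemma cvg_mxP T (F : set_system T) {FF : Filter F} m n
    (f : T -> 'M[R]_(m, n)) (M : 'M[R]_(m, n)) :
  (forall i j, f x i j @[x --> F] --> M i j) -> f x @[x --> F] --> M.
Proof.
move=> fM; apply/cvg_ballP => e e0.
have : \forall x \near F, forall i j, ball (M i j) e (f x i j).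
  apply: filter_forall => i; apply: filter_forall => j.
  exact: (cvg_ball (fM i j)).
by apply: filterS => x xe; split.
Qed.

Lemma cvg_mx_entry T (F : set_system T) {FF : Filter F} m n
    (f : T -> 'M[R]_(m, n)) (M : 'M[R]_(m, n)) i j :
  f x @[x --> F] --> M -> f x i j @[x --> F] --> M i j.
Proof.
move=> fM; apply: (@cvg_comp _ _ _ f (fun A => A i j) F (nbhs M)) => //.
exact: coord_continuous.
Qed.

Lemma cvg_mulmx T (F : set_system T) {FF : Filter F} m n q
    (f : T -> 'M[R]_(m, n)) (g : T -> 'M[R]_(n, q)) (M : 'M[R]_(m, n)) (N : 'M[R]_(n, q)) :
  f x @[x --> F] --> M -> g x @[x --> F] --> N ->
  f x *m g x @[x --> F] --> M *m N.
Proof.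
move=> fM gN; apply: cvg_mxP => i j.
under eq_fun do rewrite mxE; rewrite mxE.
apply: cvg_big => [|k _]; first exact: add_continuous.
by apply: cvgM; exact: cvg_mx_entry.
Qed.

(** Entrywise differentiability, so that the calculus of real functions applies
    directly. *)
Definition mx_derive m n (f : R -> 'M[R]_(m, n)) (t : R) (f' : 'M[R]_(m, n)) :=
  forall i j, is_derive t (1 : R) (fun s => f s i j) (f' i j).

Lemma mx_derive_cst m n (M : 'M[R]_(m, n)) t : mx_derive (cst M) t 0.
Proof. by move=> i j; rewrite mxE; exact: is_derive_cst. Qed.

Lemma mx_deriveM m n q (f : R -> 'M[R]_(m, n)) (g : R -> 'M[R]_(n, q)) t f' g' :
  mx_derive f t f' -> mx_derive g t g' ->
  mx_derive (fun s => f s *m g s) t (f' *m g t + f t *m g').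
Proof.
move=> df dg i j.
rewrite (_ : (fun s => _) = \sum_(k < n) (fun s => f s i k) * (fun s => g s k j)).
  apply: (@is_derive_eq _ _ _ _ _ _ _
      (\sum_(k < n) (f t i k *: g' k j + g t k j *: f' i k))).
    by apply: is_derive_sum => k; exact: is_deriveM.
  rewrite !mxE -big_split; apply: eq_bigr => k _ /=.
  by rewrite addrC; congr (_ + _); exact: mulrC.
apply/funext => s; rewrite mxE fct_sumE; exact: eq_bigr.
Qed.

Lemma mx_deriveN_arg m n (f : R -> 'M[R]_(m, n)) t f' :
  mx_derive f (- t) f' -> mx_derive (fun s => f (- s)) t (- f').
Proof.
move=> df i j; have h := df i j.
apply: (@is_derive_eq _ _ _ _ _ _ _ (f' i j * -1)).
  exact: (@is_derive1_comp _ (fun s => f s i j) -%R).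
by rewrite !mxE mulrN1.
Qed.

Lemma mx_derive_shift m n (f : R -> 'M[R]_(m, n)) t c f' :
  mx_derive f (t + c) f' -> mx_derive (fun s => f (s + c)) t f'.
Proof.
move=> df i j; have h := df i j.
apply: (@is_derive_eq _ _ _ _ _ _ _ (f' i j * (1 + 0))); last by rewrite addr0 mulr1.
exact: (@is_derive1_comp _ (fun s => f s i j) (fun s => s + c)).
Qed.

Lemma mx_derive0_cst m n (f : R -> 'M[R]_(m, n)) :
  (forall t, mx_derive f t 0) -> forall s t, f s = f t.
Proof.
move=> df s t; apply/matrixP => i j.
apply: (@is_derive_0_is_cst _ (fun s => f s i j)) => x.
by have := df x i j; rewrite mxE.
Qed.

End MatrixAnalysis.

Section MatrixExponential.
Context {R : realType} {d : nat}.
Implicit Types (A X : 'M[R]_d) (t : R).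

Lemma mx_exprZn A t n : (t *: A) ^+ n = t ^+ n *: A ^+ n.
Proof.
elim: n => [|n IH]; first by rewrite !expr0 scale1r.
by rewrite !exprS IH -[_ * _]/(_ *m _) -scalemxAl -scalemxAr scalerA.
Qed.

(** The entries of X exp(tA) are real power series in t. Keeping a left factor X
    makes the family stable under differentiation: X is replaced by X A. *)
Definition expmx_coef A X i j : R^nat := fun n => (X *m A ^+ n) i j / n`!%:R.

Lemma expmx_coef_bound A X i j n :
  `|(X *m A ^+ n) i j| <= `|X| * (d%:R * `|A|) ^+ n.
Proof.
elim: n i j => [|n IH] i j; first by rewrite !expr0 mulmx1 mulr1 mx_entry_le.
rewrite exprSr mulmxA (le_trans (mulmx_entry_le _ _ i j))//.
rewrite mulrCA exprSr [leRHS]mulrA ler_wpM2r ?mulr_ge0//.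
by apply: mx_norm_le => //; rewrite mulr_ge0// exprn_ge0// mulr_ge0.
Qed.

Lemma is_cvg_expmx_coef A X i j t : cvgn (pseries (expmx_coef A X i j) t).
Proof.
apply: normed_cvg.
apply: (@series_le_cvg _ _ (fun n => `|X| * exp_coeff (d%:R * `|A| * `|t|) n)).
- by move=> n; exact: normr_ge0.
- by move=> n; rewrite mulr_ge0// exp_coeff_ge0// !mulr_ge0.
- move=> n; rewrite /= /expmx_coef !normrM normrX [`|n`!%:R^-1|]ger0_norm ?invr_ge0//.
  rewrite mulrAC mulrA ler_wpM2r// ?invr_ge0//.
  rewrite [in leRHS]exprMn mulrA ler_wpM2r ?exprn_ge0//.
  exact: expmx_coef_bound.
- rewrite (_ : (fun n => _) = `|X| *: exp_coeff (d%:R * `|A| * `|t|))//.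
  apply: is_cvg_seriesZ.
  exact: is_cvg_series_exp_coeff.
Qed.

Lemma expmx_cvg A t : series (fun n => n`!%:R^-1 *: (t *: A) ^+ n) @ \oo --> expmx (t *: A).
Proof.
set M := \matrix_(i, j) limn (pseries (expmx_coef A 1%:M i j) t).
suff h : series (fun n => n`!%:R^-1 *: (t *: A) ^+ n) @ \oo --> M.
  exact: (cvgP _ h).
apply: cvg_mxP => i j; rewrite mxE.
rewrite (_ : (fun x => _) = pseries (expmx_coef A 1%:M i j) t).
  exact: is_cvg_expmx_coef.
apply/funext => n; rewrite /pseries /series /= summxE; apply: eq_bigr => k _.
by rewrite /expmx_coef mul1mx mx_exprZn !mxE; ring.
Qed.

Lemma mul_expmx_cvg A X i j t :
  pseries (expmx_coef A X i j) t @ \oo --> (X *m expmx (t *: A)) i j.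
Proof.
have h : X *m series (fun n => n`!%:R^-1 *: (t *: A) ^+ n) x @[x --> \oo]
     --> X *m expmx (t *: A).
  by apply: cvg_mulmx; [exact: cvg_cst|exact: expmx_cvg].
rewrite (_ : pseries _ _ = fun n =>
  (X *m series (fun n => n`!%:R^-1 *: (t *: A) ^+ n) n) i j).
  exact: cvg_mx_entry h.
apply/funext => n; rewrite /pseries /series /= mulmx_sumr summxE; apply: eq_bigr => k _.
by rewrite /expmx_coef mx_exprZn -!scalemxAr !mxE; ring.
Qed.

Lemma mul_expmxE A X i j t :
  (X *m expmx (t *: A)) i j = limn (pseries (expmx_coef A X i j) t).
Proof. by apply/esym/cvg_lim => //; exact: mul_expmx_cvg. Qed.

Lemma expmx_coef_diffs A X i j :
  pseries_diffs (expmx_coef A X i j) = expmx_coef A (X *m A) i j.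
Proof.
apply/funext => n; rewrite /pseries_diffs /expmx_coef factS natrM exprS mulmxA.
by rewrite mulrCA invfM mulVKf// pnatr_eq0.
Qed.

Lemma mx_derive_mul_expmx A X t :
  mx_derive (fun s => X *m expmx (s *: A)) t (X *m A *m expmx (t *: A)).
Proof.
move=> i j; under eq_fun do rewrite mul_expmxE.
rewrite mul_expmxE -expmx_coef_diffs.
apply: (@pseries_snd_diffs _ _ (`|t| + 1)); rewrite ?expmx_coef_diffs;
  try exact: is_cvg_expmx_coef.
by rewrite [ltRHS]ger0_norm ?addr_ge0// ltrDl.
Qed.

Lemma mx_derive_expmx A t :
  mx_derive (fun s => expmx (s *: A)) t (A *m expmx (t *: A)).
Proof.
have := mx_derive_mul_expmx A 1%:M t; rewrite mul1mx.
by under eq_fun do rewrite mul1mx.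
Qed.

Lemma expmx_comm A t : A *m expmx (t *: A) = expmx (t *: A) *m A.
Proof.
have h1 : A *m series (fun n => n`!%:R^-1 *: (t *: A) ^+ n) x @[x --> \oo]
     --> A *m expmx (t *: A).
  by apply: cvg_mulmx; [exact: cvg_cst|exact: expmx_cvg].
have h2 : series (fun n => n`!%:R^-1 *: (t *: A) ^+ n) x *m A @[x --> \oo]
     --> expmx (t *: A) *m A.
  by apply: cvg_mulmx; [exact: expmx_cvg|exact: cvg_cst].
suff e n : A *m series (fun n => n`!%:R^-1 *: (t *: A) ^+ n) n =
    series (fun n => n`!%:R^-1 *: (t *: A) ^+ n) n *m A.
  by move: h1; rewrite (funext e) => h1; exact: (cvg_unique _ h1 h2).
rewrite /series /= mulmx_sumr mulmx_suml; apply: eq_bigr => k _.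
by rewrite mx_exprZn -!scalemxAr -!scalemxAl; rewrite -[_ *m _]/(_ * _) -exprS exprSr.
Qed.

Lemma expmx0 A : expmx (0 *: A) = 1%:M.
Proof.
apply/matrixP => i j; rewrite -[expmx _]mul1mx mul_expmxE.
apply: cvg_lim => //; apply/cvg_ballP => e e0; near=> n.
rewrite /pseries /series /=.
have /prednK <- : (0 < n)%N by near: n; exists 1%N.
rewrite big_nat_recl// big1 ?addr0; last by move=> k _; rewrite exprS mul0r mulr0.
by rewrite /expmx_coef !expr0 mulr1 mulmx1 fact0 divr1; exact: ballxx.
Unshelve. all: by end_near. Qed.

(** The left-hand side has derivative 0 in t, since A commutes with its
    exponential, and equals exp(sA) at t = 0. The semigroup law follows without
    multiplying series. *)
Lemma expmx_shiftN A s t :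
  expmx ((- t) *: A) *m expmx ((t + s) *: A) = expmx (s *: A).
Proof.
pose f t := expmx ((- t) *: A) *m expmx ((t + s) *: A).
have -> : expmx (s *: A) = f 0 by rewrite /f oppr0 expmx0 mul1mx add0r.
apply: (@mx_derive0_cst _ _ _ f) => {}t.
have h1 := mx_deriveN_arg (mx_derive_expmx A (- t)).
have h2 := mx_derive_shift (mx_derive_expmx A (t + s)).
have := mx_deriveM h1 h2.
by rewrite mulNmx mulmxA -expmx_comm addNr.
Qed.

Lemma expmxN A t : expmx ((- t) *: A) *m expmx (t *: A) = 1%:M.
Proof. by rewrite -[in expmx (t *: A)](addr0 t) expmx_shiftN expmx0. Qed.

Lemma expmxD A s t : expmx ((s + t) *: A) = expmx (s *: A) *m expmx (t *: A).
Proof.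
have h : expmx (s *: A) *m expmx ((- s) *: A) = 1%:M.
  by rewrite -{1}(opprK s) expmxN.
by rewrite -(expmx_shiftN A t s) mulmxA h mul1mx.
Qed.

End MatrixExponential.

(** * Dissipative linear flows and their isometric subspaces *)

Section QuadraticForms.
Context {R : realType} {d : nat}.
Implicit Types (Q : 'M[R]_d) (x y v : 'cV[R]_d).

Definition normsq v : R := (v^T *m v) 0 0.

Lemma normsqE v : normsq v = \sum_i v i 0 ^+ 2.
Proof. by rewrite /normsq mxE; apply: eq_bigr => i _; rewrite mxE expr2. Qed.

Lemma normsq_ge0 v : 0 <= normsq v.
Proof. by rewrite normsqE sumr_ge0// => i _; rewrite sqr_ge0. Qed.

Lemma normsq_eq0 v : normsq v = 0 -> v = 0.
Proof.
rewrite normsqE => /eqP; rewrite psumr_eq0; last by move=> i _; rewrite sqr_ge0.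
move=> /allP v0; apply/colP => i; rewrite mxE.
by have := v0 i (mem_index_enum _); rewrite sqrf_eq0 => /eqP.
Qed.

Lemma normsq0 : normsq 0 = 0.
Proof. by rewrite /normsq mulmx0 mxE. Qed.

Lemma eucl_normE v : eucl_norm v = Num.sqrt (normsq v).
Proof. by rewrite normsqE. Qed.

Lemma mx_norm_le_normsq v : `|v| <= Num.sqrt (normsq v).
Proof.
apply: mx_norm_le; first exact: sqrtr_ge0.
move=> i j; rewrite (ord1 j) -sqrtr_sqr ler_sqrt ?normsq_ge0// normsqE.
by rewrite (bigD1 i)//= lerDl sumr_ge0// => k _; rewrite sqr_ge0.
Qed.

Lemma cvg_normsq T (F : set_system T) {FF : Filter F} (f : T -> 'cV[R]_d) v :
  f s @[s --> F] --> v -> normsq (f s) @[s --> F] --> normsq v.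
Proof.
move=> fv; rewrite /normsq.
apply: (cvg_mx_entry (f := fun s => (f s)^T *m f s)).
apply: cvg_mulmx => //; apply: cvg_mxP => i j; rewrite mxE.
under eq_fun do rewrite mxE.
exact: cvg_mx_entry.
Qed.

Lemma continuous_normsq : continuous (normsq : 'cV[R]_d -> R).
Proof. by move=> v; apply: (cvg_normsq (F := nbhs v)). Qed.

(** Positivity of Q at x - t Qx for all t forces Qx = 0: the linear term in t
    would dominate for small t > 0. *)
Lemma psd_ker Q x : Q^T = Q -> psd Q -> (x^T *m Q *m x) 0 0 = 0 -> Q *m x = 0.
Proof.
move=> Qsym Qpsd x0; apply: normsq_eq0; set y := Q *m x.
have yQ : x^T *m Q = y^T by rewrite trmx_mul Qsym.
pose b : R := (y^T *m Q *m y) 0 0.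
have b0 : 0 <= b := Qpsd y.
have a0 := normsq_ge0 y.
(* Expansion of the form at x - t y, whose constant term vanishes. *)
have key (t : R) : 0 <= t ^+ 2 * b - t * normsq y *+ 2.
  have := Qpsd (x - t *: y).
  have -> : (x - t *: y)^T = x^T - t *: y^T by rewrite linearB linearZ.
  rewrite !mulmxBl !mulmxBr -!scalemxAl -!scalemxAr yQ.
  rewrite -[y^T *m Q *m x]mulmxA -/y !mxE.
  move: x0; rewrite yQ mxE => ->.
  by rewrite /b /normsq !mxE; lra.
(* At this t the bound reads 0 <= - t^2 (b + 2), hence t = 0. *)
have := key (normsq y / (b + 1)).
have b1 : 0 < b + 1 by lra.
set r := normsq y / (b + 1).
have yr : normsq y = r * (b + 1) by rewrite /r divfK// gt_eqF.
rewrite {1}yr (_ : r ^+ 2 * b - r * (r * (b + 1)) *+ 2 = - (r ^+ 2 * (b + 2))); last by ring.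
rewrite oppr_ge0 pmulr_lle0; last lra.
move=> h; have : r ^+ 2 == 0 by rewrite eq_le h sqr_ge0.
by rewrite sqrf_eq0 yr => /eqP ->; rewrite mul0r.
Qed.

End QuadraticForms.

Section RealDerivatives.
Context {R : realType}.
Implicit Types f df : R -> R.

Lemma is_derive_MVT f df (a b : R) : (forall x, is_derive x (1 : R) f (df x)) ->
  a <= b -> exists2 c, c \in `[a, b] & f b - f a = df c * (b - a).
Proof.
move=> fdf ab; apply: MVT_segment => //.
by apply: derivable_within_continuous => x _; case: (fdf x).
Qed.

Lemma is_derive_locally0 f (a b x f' : R) : (forall y, y \in `]a, b[ -> f y = 0) ->
  x \in `]a, b[ -> is_derive x (1 : R) f f' -> f' = 0.
Proof.
move=> f0 xab [_ <-]; rewrite -(derive_cst (0 : R^o) x 1).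
apply: near_eq_derive.
by near=> y; apply: f0; near: y; exact: near_in_itvoo.
Unshelve. all: by end_near. Qed.

End RealDerivatives.

Section DissipativeFlow.
Context {R : realType} {d : nat}.
Variable A : 'M[R]_d.
Hypothesis Adiss : nsd (A^T + A).
Implicit Types (v : 'cV[R]_d) (s t : R).

Definition flow t v : 'cV[R]_d := expmx (t *: A) *m v.

Lemma flow0 v : flow 0 v = v.
Proof. by rewrite /flow expmx0 mul1mx. Qed.

Lemma flowD s t v : flow (s + t) v = flow s (flow t v).
Proof. by rewrite /flow expmxD mulmxA. Qed.

Lemma mx_derive_flow v t : mx_derive (fun s => flow s v) t (A *m flow t v).
Proof.
have := mx_deriveM (mx_derive_expmx A t) (mx_derive_cst v t).
by rewrite mulmx0 addr0 -mulmxA.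
Qed.

Lemma mx_derive_mul_flow (X : 'M[R]_d) v t :
  mx_derive (fun s => X *m flow s v) t (X *m A *m flow t v).
Proof.
have := mx_deriveM (mx_derive_cst X t) (mx_derive_flow v t).
by rewrite mul0mx add0r mulmxA.
Qed.

Lemma is_derive_normsq_flow v t : is_derive t (1 : R) (fun s => normsq (flow s v))
  (((flow t v)^T *m (A^T + A) *m flow t v) 0 0).
Proof.
have dT : mx_derive (fun s => (flow s v)^T) t (A *m flow t v)^T.
  by move=> i j; rewrite mxE; under eq_fun do rewrite mxE; exact: mx_derive_flow.
have := mx_deriveM dT (mx_derive_flow v t) 0 0.
by rewrite trmx_mul mulmxA -mulmxDl -mulmxDr.
Qed.

Lemma normsq_flow_le v s t : s <= t -> normsq (flow t v) <= normsq (flow s v).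
Proof.
move=> st; have [c _ e] := is_derive_MVT (is_derive_normsq_flow v) st.
by rewrite -subr_le0 e mulr_le0_ge0 ?subr_ge0//; exact: Adiss.
Qed.

Lemma continuous_flow t : continuous (flow t).
Proof. by move=> v; apply: (cvg_mulmx (F := nbhs v)) => //; exact: cvg_cst. Qed.

(** Dissipativity bounds |flow s v| by |v|, hence the speed |A flow s v|, and the
    mean value theorem applies to each coordinate. *)
Lemma flow_lipschitz v t (r : R) : 0 <= t -> normsq v <= r ->
  `|flow t v - v| <= d%:R * `|A| * Num.sqrt r * t.
Proof.
move=> t0 vr; apply: mx_norm_le; first by rewrite !mulr_ge0 ?sqrtr_ge0.
move=> i j; have -> : (flow t v - v) i j = flow t v i j - v i j.
  by rewrite mxE; congr (_ + _); rewrite mxE.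
have [c] := is_derive_MVT (fun s => mx_derive_flow v s i j) t0.
rewrite in_itv/= => /andP[c0 _].
rewrite flow0 subr0 => ->.
rewrite normrM (ger0_norm t0) ler_wpM2r// (le_trans (mulmx_entry_le _ _ i j))//.
rewrite -mulrA ler_wpM2l// ler_wpM2l// (le_trans (mx_norm_le_normsq _))//.
rewrite ler_sqrt ?(le_trans _ vr) ?normsq_ge0//.
by have := normsq_flow_le v c0; rewrite flow0.
Qed.

Definition energy_loss t v := normsq v - normsq (flow t v).

Lemma continuous_energy_loss t : continuous (energy_loss t).
Proof.
move=> v; apply: (@cvgB _ _ _ (nbhs v)).
  by apply: (cvg_normsq (F := nbhs v)).
by apply: (cvg_normsq (F := nbhs v)); exact: continuous_flow.
Qed.

Lemma energy_loss_ge0 t v : 0 <= t -> 0 <= energy_loss t v.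
Proof. by move=> t0; rewrite subr_ge0 -{2}(flow0 v) normsq_flow_le. Qed.

Lemma isometricE v :
  isometric_set A v <-> forall t, normsq (flow t v) = normsq v.
Proof.
rewrite /isometric_set /=; split => h t.
  have := h t; rewrite !eucl_normE => /eqP.
  by rewrite eqr_sqrt ?normsq_ge0// => /eqP.
by rewrite !eucl_normE; congr Num.sqrt; exact: h.
Qed.

(** Substitute for analyticity: a norm that is constant on a short interval is
    constant for all times, negative ones included. *)
Lemma energy_loss0_isometric t v : 0 < t -> energy_loss t v = 0 -> isometric_set A v.
Proof.
move=> t0 /eqP; rewrite subr_eq0 => /eqP vt.
pose Q := A^T + A.
have QT : Q^T = Q by rewrite /Q linearD /= trmxK addrC.
have Qker (x : 'cV[R]_d) : (x^T *m Q *m x) 0 0 = 0 -> Q *m x = 0.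
  move=> x0; apply/eqP; rewrite -oppr_eq0 -mulNmx; apply/eqP; apply: psd_ker.
  - by rewrite linearN /= QT.
  - by move=> y; rewrite mulmxN mulNmx mxE oppr_ge0; exact: Adiss.
  - by rewrite mulmxN mulNmx mxE x0 oppr0.
have cst s : s \in `]0, t[ -> normsq (flow s v) - normsq v = 0.
  rewrite in_itv /= => /andP[/ltW s0 /ltW st].
  apply/eqP; rewrite subr_eq0 eq_le {2}vt normsq_flow_le// andbT.
  by rewrite -{2}(flow0 v) normsq_flow_le.
have Q0 s : s \in `]0, t[ -> Q *m flow s v = 0.
  move=> st; apply: Qker.
  apply: (@is_derive_locally0 _ (fun s => normsq (flow s v) - normsq v) _ _ _ _ cst st).
  have h := is_derive_normsq_flow v s.
  apply: (@is_derive_eq _ _ _ _ _ _ _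
    (((flow s v)^T *m Q *m flow s v) 0 0 - 0)); by rewrite subr0.
have Qk k s : s \in `]0, t[ -> Q *m A ^+ k *m flow s v = 0.
  elim: k s => [|k IH] s st; first by rewrite expr0 mulmx1; exact: Q0.
  rewrite exprSr -[_ ^+ _ * _]/(_ *m _) (mulmxA Q); apply/matrixP => i j; rewrite [RHS]mxE.
  have f0 y : y \in `]0, t[ -> (Q *m A ^+ k *m flow y v) i j = 0.
    by move=> yt; rewrite IH// mxE.
  exact: (is_derive_locally0 f0 st (mx_derive_mul_flow _ _ _ _ _)).
(* Any base point of ]0, t[ serves to expand the flow around. *)
have t2 : t / 2 \in `]0, t[ by rewrite in_itv /=; apply/andP; split; lra.
have Qall s : Q *m flow s v = 0.
  rewrite -(subrK (t / 2) s) flowD /flow -/(flow _ v) mulmxA.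
  set r := s - _; set w := flow _ v.
  have h : Q *m series (fun n => n`!%:R^-1 *: (r *: A) ^+ n) x *m w @[x --> \oo]
     --> Q *m expmx (r *: A) *m w.
    apply: cvg_mulmx; last exact: cvg_cst.
    by apply: cvg_mulmx; [exact: cvg_cst|exact: expmx_cvg].
  suff e n : Q *m series (fun n => n`!%:R^-1 *: (r *: A) ^+ n) n *m w = 0.
    by move: h; rewrite (funext e) => h; exact: (cvg_unique _ h (cvg_cst _)).
  rewrite /series /= mulmx_sumr mulmx_suml big1// => k _.
  by rewrite mx_exprZn -!scalemxAr -!scalemxAl Qk// !scaler0.
apply/isometricE => s; rewrite -{2}(flow0 v).
apply: (@is_derive_0_is_cst _ (fun s => normsq (flow s v))) => r.
have := is_derive_normsq_flow v r.
by rewrite -/Q -mulmxA Qall mulmx0 mxE.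
Qed.

Lemma isometric_energy_loss0 t v : isometric_set A v -> energy_loss t v = 0.
Proof. by move=> /isometricE h; rewrite /energy_loss h subrr. Qed.

(** The matrix of the quadratic form [energy_loss 1]. Its kernel is the isometric
    set, which is thereby linear. *)
Definition loss_form : 'M[R]_d := 1%:M - (expmx (1 *: A))^T *m expmx (1 *: A).

Lemma loss_formE v : energy_loss 1 v = (v^T *m loss_form *m v) 0 0.
Proof.
rewrite /loss_form mulmxBr mulmxBl mulmx1 /energy_loss /normsq /flow trmx_mul !mulmxA.
by rewrite [RHS]mxE [X in _ = _ + X]mxE.
Qed.

Lemma isometric_ker v : isometric_set A v <-> loss_form *m v = 0.
Proof.
split => [vV|v0].
  apply: psd_ker; last by rewrite -loss_formE isometric_energy_loss0.
    by rewrite linearB /= trmx1 trmx_mul trmxK.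
  by move=> x; rewrite -loss_formE energy_loss_ge0.
by apply: (@energy_loss0_isometric 1) => //; rewrite loss_formE -mulmxA v0 mulmx0 mxE.
Qed.

Lemma isometric_set_vspan : [set` vspan (isometric_set A)] = isometric_set A.
Proof.
apply: vspan_submod; first by apply/isometric_ker; rewrite mulmx0.
move=> a x y /isometric_ker x0 /isometric_ker y0; apply/isometric_ker.
by rewrite mulmxDr -scalemxAr x0 y0 scaler0 addr0.
Qed.

End DissipativeFlow.

(** * Trajectories of the switched system *)

Section SwitchingTimes.
Context {R : realType} {p : nat}.
Variable u : input R p.
Implicit Types (s t : R) (m n : nat).

Lemma swt_le m n : (m <= n)%N -> swt u m <= swt u n.
Proof.
by rewrite leq_eqVlt => /predU1P[->//|mn]; exact/ltW/(@swt_incr _ _ u).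
Qed.

Lemma swt_ge0 n : 0 <= swt u n.
Proof. by rewrite -(swt0 u) swt_le. Qed.

Lemma swt_unbounded t : exists n, forall m, (n <= m)%N -> t < swt u m.
Proof.
have [N _ hN] := (cvgryPgt (swt u)).1 (swt_cvgy u) t.
by exists N.
Qed.

Lemma swt_piece t : 0 <= t -> exists n, swt u n <= t < swt u n.+1.
Proof.
move=> t0; have [N /(_ N (leqnn N)) tN] := swt_unbounded t.
have exP : exists n, t < swt u n by exists N.
case: (ex_minnP exP) => -[|n] tn minn; first by move: tn; rewrite swt0 ltNge t0.
exists n; rewrite tn andbT leNgt; apply/negP => /minn; by rewrite ltnn.
Qed.

Lemma swt_piece_uniq t m n :
  swt u m <= t < swt u m.+1 -> swt u n <= t < swt u n.+1 -> m = n.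
Proof.
move=> /andP[mt tm] /andP[nt tn]; apply/eqP; rewrite eqn_leq.
apply/andP; split; rewrite leqNgt; apply/negP => /swt_le h.
  by have := le_lt_trans (le_trans h mt) tn; rewrite ltxx.
by have := le_lt_trans (le_trans h nt) tm; rewrite ltxx.
Qed.

(** All properties of trajectories on an interval are proved first between two
    consecutive switching times and then by concatenation. Closed pieces are
    used, so that consecutive ones share an endpoint. *)
Lemma piecewise_ind (P : R -> R -> Prop) :
  (forall s r t, s <= r -> r <= t -> P s r -> P r t -> P s t) ->
  (forall n s t, swt u n <= s -> s <= t -> t <= swt u n.+1 -> P s t) ->
  forall s t, 0 <= s -> s <= t -> P s t.
Proof.
move=> Ptrans Ppiece s t s0 st.
have [n /andP[ns sn]] := swt_piece s0.
have [m /andP[mt tm]] := swt_piece (le_trans s0 st).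
have [mn|nm] := leqP m n.
  by apply: (Ppiece n) => //; apply: (le_trans (ltW tm)); exact: swt_le.
have Ps k : (n < k)%N -> P s (swt u k).
  elim: k => // k IH; rewrite ltnS leq_eqVlt => /predU1P[<-|nk].
    exact: (Ppiece n _ _ ns (ltW sn)).
  have kk : swt u k <= swt u k.+1 by exact: swt_le.
  apply: (Ptrans _ (swt u k)) => //; last exact: (Ppiece k).
    by rewrite (le_trans (ltW sn))// swt_le.
  exact: IH.
apply: (Ptrans _ (swt u m)) => //; last exact: (Ppiece m _ _ _ _ (ltW tm)).
  by rewrite (le_trans (ltW sn))// swt_le.
exact: Ps.
Qed.

End SwitchingTimes.

Section Trajectory.
Context {R : realType} {d p : nat}.
Variables (B : 'I_p -> 'M[R]_d) (u : input R p) (x : 'cV[R]_d).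
Hypothesis hB : forall i, nsd ((B i)^T + B i).
Implicit Types (s t : R) (m n : nat).

Definition traj t : 'cV[R]_d := Phi B u t *m x.

(** The formula also holds at the right endpoint: this is the continuity of [Phi]
    at the switching times. *)
Lemma PhiE n t : swt u n <= t <= swt u n.+1 ->
  Phi B u t = expmx ((t - swt u n) *: B (mode u n)) *m Phi_swt B u n.
Proof.
have main m s : swt u m <= s < swt u m.+1 ->
    Phi B u s = expmx ((s - swt u m) *: B (mode u m)) *m Phi_swt B u m.
  move=> h; rewrite /Phi (_ : xget _ _ = m)//.
  by case: xgetP => [k _ /= hk|/(_ m)//]; exact: (swt_piece_uniq hk h).
move=> /andP[nt]; rewrite le_eqVlt => /predU1P[->|tn]; last first.
  by apply: main; rewrite nt.
rewrite (main n.+1) ?lexx ?(@swt_incr _ _ u)//.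
by rewrite subrr expmx0 mul1mx.
Qed.

Lemma traj_piece n s t : swt u n <= s -> s <= t -> t <= swt u n.+1 ->
  traj t = flow (B (mode u n)) (t - s) (traj s).
Proof.
move=> ns st tn; rewrite /traj (PhiE (n := n)) ?(le_trans ns st)//.
rewrite (PhiE (n := n)) ?ns ?(le_trans st tn)//.
by rewrite -!mulmxA -!/(flow _ _ _) -flowD addrA subrK.
Qed.

(** Several switching times may lie between s and t when consecutive modes are
    equal; the semigroup law glues the pieces. *)
Lemma traj_const (i : 'I_p) s t : 0 <= s -> s <= t ->
  (forall r, s <= r < t -> u r = i) -> traj t = flow (B i) (t - s) (traj s).
Proof.
move: s t; apply: (piecewise_ind (u := u)) => [s r t sr rt IH1 IH2 ui|n s t ns st tn ui].
  rewrite IH2 ?IH1; last 2 first.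
  - by move=> q /andP[sq qr]; apply: ui; rewrite sq (lt_le_trans qr).
  - by move=> q /andP[rq qt]; apply: ui; rewrite qt (le_trans sr).
  by rewrite -flowD addrA subrK.
move: st; rewrite le_eqVlt => /predU1P[->|st]; first by rewrite subrr flow0.
rewrite (traj_piece ns (ltW st) tn) (_ : mode u n = i)//.
by rewrite -(ui s) ?lexx// (@input_const _ _ u n s)// ns (lt_le_trans st).
Qed.

Lemma normsq_traj_le s t : 0 <= s -> s <= t -> normsq (traj t) <= normsq (traj s).
Proof.
move: s t; apply: (piecewise_ind (u := u)) => [s r t _ _ IH1 IH2|n s t ns st tn].
  exact: le_trans IH2 IH1.
rewrite (traj_piece ns st tn) -[in leRHS](flow0 (B (mode u n)) (traj s)).
by apply: normsq_flow_le => //; rewrite subr_ge0.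
Qed.

Lemma traj0 : traj 0 = x.
Proof.
rewrite /traj (PhiE (n := 0)) ?swt0 ?lexx ?swt_ge0//.
by rewrite subrr expmx0 !mul1mx.
Qed.

(** A crude bound for the velocity of the trajectory: a sum over the modes replaces
    their maximum. *)
Definition speed : R := \sum_i d%:R * `|B i| * Num.sqrt (normsq x).

Lemma speed_ge0 : 0 <= speed.
Proof. by rewrite sumr_ge0// => i _; rewrite !mulr_ge0 ?sqrtr_ge0. Qed.

Lemma traj_lipschitz s t : 0 <= s -> s <= t ->
  `|traj t - traj s| <= speed * (t - s).
Proof.
move: s t; apply: (piecewise_ind (u := u)) => [s r t _ _ IH1 IH2|n s t ns st tn].
  rewrite -(subrK (traj r) (traj t)) -addrA (le_trans (ler_normD _ _))//.
  by rewrite (le_trans (lerD IH2 IH1))// -mulrDr addrA subrK.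
have s0 : 0 <= s := le_trans (swt_ge0 u n) ns.
rewrite (traj_piece ns st tn).
have := normsq_traj_le (lexx 0) s0; rewrite traj0 => sx.
have ts : 0 <= t - s by rewrite subr_ge0.
rewrite (le_trans (flow_lipschitz (hB _) ts sx))// ler_wpM2r//.
rewrite /speed (bigD1 (mode u n))//= lerDl sumr_ge0//.
Qed.

Lemma traj_bounded t : 0 <= t -> `|traj t| <= Num.sqrt (normsq x).
Proof.
move=> t0; rewrite (le_trans (mx_norm_le_normsq _))// ler_sqrt ?normsq_ge0//.
by have := normsq_traj_le (lexx 0) t0; rewrite traj0.
Qed.

Lemma normsq_traj_cvg : exists r : R, normsq (traj t) @[t --> +oo] --> r.
Proof.
pose E := [set normsq (traj t) | t in [set t | 0 <= t]].
have E0 : has_inf E.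
  split; first by exists (normsq (traj 0)), 0 => /=.
  by exists 0 => _ [t _ <-]; exact: normsq_ge0.
exists (inf E); apply/cvgrPdist_lt => e e0.
have [_ [T /= T0 <-] hT] := inf_adherent e0 E0.
near=> t.
have Tt : T <= t by near: t; apply: nbhs_pinfty_ge; rewrite num_real.
have h1 : inf E <= normsq (traj t).
  by apply: ge_inf; [exact: E0.2|exists t => //=; exact: le_trans Tt].
have h2 := normsq_traj_le T0 Tt.
by rewrite ltr_distlC; apply/andP; split; lra.
Unshelve. all: by end_near. Qed.

Lemma continuous_traj (a b : R) : 0 <= a -> {within `[a, b], continuous traj}.
Proof.
move=> a0; apply/subspace_continuousP => t /= ; rewrite in_itv /= => /andP[at_ tb].
apply/cvgrPdist_lt => e e0.
have C1 : 0 < speed + 1 by have := speed_ge0; lra.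
rewrite near_withinE; near=> s => /=; rewrite in_itv /= => /andP[as_ sb].
have h : `|t - s| < e / (speed + 1).
  by near: s; apply: cvgr_dist_lt; [exact: cvg_id|rewrite divr_gt0].
suff : `|traj t - traj s| <= speed * `|t - s|.
  move=> /le_lt_trans; apply; rewrite ltr_pdivlMr// in h.
  by have := normr_ge0 (t - s); have := speed_ge0; nra.
have [st|ts] := leP s t.
  by rewrite [in leRHS]ger0_norm ?subr_ge0// traj_lipschitz// (le_trans a0).
rewrite distrC [in leRHS]distrC [in leRHS]ger0_norm ?subr_ge0 ?(ltW ts)//.
by rewrite traj_lipschitz ?(ltW ts)// (le_trans a0).
Unshelve. all: by end_near. Qed.

End Trajectory.

(** * Limit points of a trajectory *)

Section Clusters.
Context {R : realType}.

Lemma cluster_closed (T : topologicalType) (F : set_system T) (K : set T) w :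
  closed K -> F K -> cluster F w -> K w.
Proof. by move=> Kc FK; rewrite clusterE => /(_ K FK) /Kc. Qed.

(** A cluster point of F is the limit of a finer filter, along which f has both
    limits. *)
Lemma cluster_cvg_image (T : topologicalType) (F : set_system T) {FF : Filter F}
    (f : T -> R) w (c : R) :
  {for w, continuous f} -> cluster F w -> f v @[v --> F] --> c -> f w = c.
Proof.
move=> fw; rewrite cluster_cvgE => -[G GP [Gw FG]] fc.
have h1 : f v @[v --> G] --> f w.
  by apply: (@cvg_comp _ _ _ id f G (nbhs w) (nbhs (f w))).
have h2 : f v @[v --> G] --> c by apply: cvg_trans fc => A; exact: FG.
exact: (cvg_unique _ h1 h2).
Qed.

Lemma cV_ball_compact d (r : R) : compact [set v : 'cV[R]_d | `|v| <= r].
Proof.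
have -> : [set v : 'cV[R]_d | `|v| <= r] = trmx @` [set v : 'rV[R]_d | `|v| <= r].
  apply/seteqP; split => [v /= vr|_ [v /= vr <-]].
    exists v^T; last by rewrite trmxK.
    apply: mx_norm_le => [|i j]; first exact: le_trans vr.
    by rewrite mxE (le_trans _ vr)// mx_entry_le.
  apply: mx_norm_le => [|i j]; first exact: le_trans vr.
  by rewrite mxE (le_trans _ vr)// mx_entry_le.
apply: continuous_compact.
  apply: continuous_subspaceT => v; apply: (cvg_mxP (F := nbhs v)) => i j.
  by rewrite mxE; under eq_fun do rewrite mxE; exact: coord_continuous.
apply: bounded_closed_compact.
  by exists r; split; [exact: num_real|move=> M rM v /= /le_trans; apply; exact: ltW].
rewrite (_ : [set _ | _] = (fun v : 'rV[R]_d => `|v|) @^-1` [set x | x <= r])//.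
apply: closed_comp; last exact: closed_le.
by move=> v _; exact: norm_continuous.
Qed.

Definition frequently (P : set R) := forall T : R, exists2 t, T <= t & P t.

Lemma within_frequently (P : set R) : frequently P ->
  ProperFilter (within P (pinfty_nbhs R)).
Proof.
move=> Pf; split; last exact: within_filter.
case => M [Mr hM]; have [t Mt Pt] := Pf (M + 1).
by apply: (hM t) => //; rewrite (lt_le_trans _ Mt)// ltrDl.
Qed.

(** Pigeonhole over finitely many modes. *)
Lemma frequently_bigcup (I : finType) (P : set R) (Q : I -> set R) :
  frequently P -> (forall t, P t -> exists i, Q i t) -> exists i, frequently (Q i).
Proof.
move=> Pf PQ; apply: contrapT => /forallNP nQ.
have : \forall t \near +oo, forall i, ~ Q i t.
  apply: filter_forall => i; have /existsNP[T hT] := nQ i.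
  exists T; split; first exact: num_real.
  by move=> t /ltW Tt Qt; apply: hT; exists t.
case => M [_ hM]; have [t Mt /PQ[i Qi]] := Pf (M + 1).
by apply: (hM t _ i Qi); rewrite (lt_le_trans _ Mt)// ltrDl.
Qed.

End Clusters.

Section LimitSet.
Context {R : realType} {d p : nat}.
Variables (B : 'I_p -> 'M[R]_d) (u : input R p) (x : 'cV[R]_d).
Hypothesis hB : forall i, nsd ((B i)^T + B i).
Implicit Types (s t : R) (m n : nat) (w : 'cV[R]_d).
Local Notation y := (traj B u x).
Variable r : R.
Hypothesis yr : normsq (y t) @[t --> +oo] --> r.

Definition limit_pt w := cluster (y t @[t --> +oo]) w.

(** The trajectory is bounded, so it has cluster points along any unbounded set of
    times. *)
Lemma frequently_cluster (P : set R) : frequently P ->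
  exists2 w, limit_pt w & cluster (y t @[t --> within P (pinfty_nbhs R)]) w.
Proof.
move=> /within_frequently PF.
have FK : (y t @[t --> within P (pinfty_nbhs R)])
    [set v | `|v| <= Num.sqrt (normsq x)].
  have := @nbhs_pinfty_ge R 0 (num_real _).
  by apply: filterS => t t0 _; exact: traj_bounded.
have [w [_ wc]] := cV_ball_compact _ FK.
exists w => //; move: w wc; apply: cvg_cluster => A.
by move=> h; apply: (@filterS _ (pinfty_nbhs R) _ _ _ _ h) => t Ayt _.
Qed.

Lemma limit_pt_frequently w (K : set 'cV[R]_d) : limit_pt w -> nbhs w K ->
  frequently (fun t => 0 <= t /\ K (y t)).
Proof.
move=> wl wK T.
have FT : (y t @[t --> +oo]) (y @` [set t | T <= t /\ 0 <= t]).
  have h := @nbhs_pinfty_ge R (Num.max T 0) (num_real _).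
  by apply: filterS h => t; rewrite ge_max => /andP[Tt t0]; exists t.
have [_ [[t [Tt t0] <-] Kt]] := wl _ _ FT wK.
by exists t.
Qed.

Lemma limit_pt_normsq w : limit_pt w -> normsq w = r.
Proof.
move=> wl; apply: (cluster_cvg_image _ wl); last exact: yr.
exact: continuous_normsq.
Qed.

(** The energy loss over [t, t + eps] is |y(t)|^2 - |y(t + eps)|^2 when t is in P;
    it tends to r - r = 0, so it vanishes at every cluster point along P. *)
Lemma frequently_mode_limit (i : 'I_p) (eps : R) (P : set R) : 0 < eps ->
  frequently P ->
  (forall t, P t -> 0 <= t /\ forall q, t <= q < t + eps -> u q = i) ->
  exists w, [/\ limit_pt w, Vset B i w &
    cluster (y t @[t --> within P (pinfty_nbhs R)]) w].
Proof.
move=> e0 Pf Pi; have [w wl wc] := frequently_cluster Pf.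
have PF := within_frequently Pf.
exists w; split => //; apply: (energy_loss0_isometric (hB i) e0).
apply: (cluster_cvg_image _ wc); first exact: continuous_energy_loss.
have yre : normsq (y (t + eps)) @[t --> +oo] --> r.
  apply/cvgrPdist_lt => e e0'; have [M [Mr hM]] := (cvgrPdist_lt _ _).1 yr e e0'.
  by exists M; split=> // t Mt; apply: hM; rewrite (lt_trans Mt)// ltrDl.
have dr : normsq (y t) - normsq (y (t + eps)) @[t --> +oo] --> r - r.
  exact: cvgB.
rewrite subrr in dr.
apply/cvgrPdist_lt => e /((cvgrPdist_lt _ _).1 dr) hd.
apply: (@filterS _ (pinfty_nbhs R) _ _ _ _ hd) => t h Pt; have [t0 ui] := Pi t Pt.
have := h; rewrite /energy_loss.
have te : t <= t + eps by rewrite lerDl ltW.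
by rewrite (traj_const _ _ t0 te ui) [t + eps]addrC addrK.
Qed.

Lemma hypH_limit (i : 'I_p) : hypH u i -> exists2 w, limit_pt w & Vset B i w.
Proof.
move=> [n [nincr [delta [d0 nd]]]].
have [||w [wl wi _]] := @frequently_mode_limit i delta [set swt u (n k) | k in setT] d0.
- move=> T; have [N hN] := swt_unbounded u T.
  exists (swt u (n N)); last by exists N.
  apply/ltW/hN; elim: N {hN} => // N IH; exact: leq_ltn_trans IH (nincr _ _ (ltnSn N)).
- move=> _ [k _ <-]; split; first exact: swt_ge0.
  move=> q /andP[kq qd]; have [<- h] := nd k.
  rewrite (@input_const _ _ u (n k))// kq (lt_le_trans qd)//.
  by move: h; rewrite /dwell; lra.
by exists w.
Qed.

(** If w were in no V_i, a ball of radius rho around w would avoid all of them. With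
    windows so short that y moves by at most rho / 2, the intervals of constancy
    provided by the absence of chaos start in that ball, and a cluster point of
    their starting positions lies in the ball and in some V_i. *)
Lemma limit_pt_isometric w : ~ chaotic u -> limit_pt w -> exists i, Vset B i w.
Proof.
move=> nchaos wl; apply: contrapT => /forallNP nV.
pose K (rho : R) := [set v : 'cV[R]_d | `|w - v| <= rho].
have [rho rho0 hrho] : exists2 rho, 0 < rho & forall v, K rho v -> forall i, ~ Vset B i v.
  have : \forall v \near w, forall i, energy_loss (B i) 1 v != 0.
    apply: (@filter_forall _ _ _ (nbhs w)) => i.
    have w0 : energy_loss (B i) 1 w != 0.
      by apply/eqP => /(energy_loss0_isometric (hB i) ltr01); exact: nV.
    have nb : nbhs (energy_loss (B i) 1 w) [set z | z != 0].
      by apply: open_nbhs_nbhs; split; [exact: open_neq|exact: w0].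
    exact: (@continuous_energy_loss _ _ (B i) 1 w _ nb).
  move=> /nbhs_ballP[e /= e0 he]; exists (e / 2); first by rewrite divr_gt0.
  move=> v Kv i vi; have : ball w e v.
    rewrite -ball_normE /=; apply: le_lt_trans Kv _.
    by rewrite ltr_pdivrMr// ltr_pMr// ltr1n.
  by move=> /he /(_ i); rewrite isometric_energy_loss0// eqxx.
have Kclosed : closed (K rho).
  rewrite (_ : K rho = (fun v => `|w - v|) @^-1` [set z | z <= rho])//.
  apply: closed_comp; last exact: closed_le.
  move=> v _; apply: (@cvg_norm _ _ _ (nbhs v)); apply: (@cvgB _ _ _ (nbhs v)) => //.
  exact: cvg_cst.
(* The summand 1 keeps the divisor below positive even if x = 0. *)
pose C := speed B x + 1.
have C0 : 0 < C by have := speed_ge0 B x; rewrite /C; lra.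
pose tau := rho / 2 / C.
have tau0 : 0 < tau by rewrite !divr_gt0.
have near_w : frequently (fun t => 0 <= t /\ K (rho / 2) (y t)).
  apply: (limit_pt_frequently (K := K (rho / 2)) wl).
  have h : nbhs w (ball w (rho / 2)) by apply: nbhsx_ballx; rewrite divr_gt0.
  by apply: (@filterS _ (nbhs w) _ _ _ _ h) => v; rewrite -ball_normE /K /= => /ltW.
have tex (k : nat) : exists t, k%:R <= t /\ 0 <= t /\ K (rho / 2) (y t).
  by have [t kt ht] := near_w k%:R; exists t.
pose tk k := projT1 (cid (tex k)).
have tkP k : k%:R <= tk k /\ 0 <= tk k /\ K (rho / 2) (y (tk k)).
  exact: (projT2 (cid (tex k))).
have [eps [eps0 heps]] : exists eps : R, 0 < eps /\ forall k0 : nat, exists k b c,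
    [/\ (k0 <= k)%N, tk k <= b, c <= tk k + tau, eps <= c - b &
     forall s s', s \in `[b, c] -> s' \in `[b, c] -> u s = u s'].
  apply: contrapT => /forallNP neps; apply: nchaos; exists tau; split => //.
  exists tk; split.
  - by move=> k; have [_ []] := tkP k.
  - apply/cvgryPge => M; near=> k; have [h _] := tkP k; apply: le_trans h.
    by near: k; exact: nbhs_infty_ger.
  - move=> eps eps0; have /not_andP[//|/existsNP[k0 hk0]] := neps eps.
    exists k0 => k kk b c tb ct ebc ucst; apply: hk0.
    by exists k, b, c.
pose Q (i : 'I_p) := [set t | [/\ 0 <= t, K rho (y t) &
  forall q, t <= q < t + eps -> u q = i]].
have [i Qi] : exists i, frequently (Q i).
  apply: (@frequently_bigcup _ _ [set t | exists i, Q i t]) => // T.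
  have [N TN] : exists N : nat, T <= N%:R.
    exists (Num.bound `|T|); apply: le_trans (ler_norm _) _.
    by apply/ltW/archi_boundP; exact: normr_ge0.
  have [k [b [c [kk tb ct ebc ucst]]]] := heps N.
  have [ktk [tk0 Kt]] := tkP k.
  exists b; first by rewrite (le_trans TN)// (le_trans _ tb)// (le_trans _ ktk)// ler_nat.
  exists (u b); split.
  - exact: le_trans tb.
  - rewrite /K /= -(subrK (y (tk k)) w) -addrA (le_trans (ler_normD _ _))//.
    rewrite (splitr rho) lerD// distrC (le_trans (traj_lipschitz u x hB tk0 tb))//.
    have bt : b - tk k <= tau by lra.
    have : speed B x * (b - tk k) <= C * tau.
      by rewrite ler_pM ?speed_ge0 ?subr_ge0// /C lerDl.
    by move/le_trans; apply; rewrite /tau mulrC divfK// gt_eqF.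
  - move=> q /andP[bq qb]; apply: ucst; rewrite in_itv /=; apply/andP; split; lra.
have Qp t : Q i t -> 0 <= t /\ forall q, t <= q < t + eps -> u q = i by case.
have [v [_ vi vc]] := frequently_mode_limit eps0 Qi Qp.
apply: (hrho v _ i vi); apply: (cluster_closed Kclosed _ vc).
by apply: (@filterE _ (pinfty_nbhs R)) => t [].
Unshelve. all: by end_near. Qed.

(** Let g_J be the product over J of the energy losses, so that g_J vanishes exactly
    on the union of the V_j, j in J. If the V_i with i in I met the V_j with j
    outside I only at 0, then g_I - g_(~ I) would take both signs along y at
    arbitrarily large times. By the intermediate value theorem it would vanish at
    arbitrarily large times, hence at some limit point z. As z lies in some V_k,
    one of the two products vanishes at z, hence both do, and z = 0. *)
Lemma limit_set_connected (I : {set 'I_p}) (i0 j0 : 'I_p) :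
  regular u -> r != 0 -> i0 \in I -> j0 \notin I ->
  exists i j, [/\ i \in I, j \notin I & exists2 v, v != 0 & Vset B i v /\ Vset B j v].
Proof.
move=> [nchaos Hi] r0 i0I j0I.
apply: contrapT => nex.
have sep i j v : i \in I -> j \notin I -> Vset B i v -> Vset B j v -> v = 0.
  move=> iI jI vi vj; apply/eqP/negPn/negP => v0; apply: nex.
  by exists i, j; split => //; exists v.
pose g (J : {set 'I_p}) v := \prod_(i in J) energy_loss (B i) 1 v.
have g_cont J : continuous (g J).
  apply: continuous_big; first exact: mul_continuous.
  by move=> i _; exact: continuous_energy_loss.
have energy_loss0 i v : energy_loss (B i) 1 v = 0 <-> Vset B i v.
  by split; [exact: energy_loss0_isometric|exact: isometric_energy_loss0].
have g_eq0 J v : g J v = 0 <-> exists2 i, i \in J & Vset B i v.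
  split => [/eqP /prodf_eq0[i iJ /eqP /energy_loss0 vi]|[i iJ /energy_loss0 vi]]; first by exists i.
  by rewrite /g (bigD1 i)//= vi mul0r.
have g_ge0 J v : 0 <= g J v.
  by apply: prodr_ge0 => i _; exact: energy_loss_ge0.
have limit_neq0 v : limit_pt v -> v != 0.
  by move=> /limit_pt_normsq vr; apply: contra_neq r0 => v0; rewrite -vr v0 normsq0.
pose h v := g I v - g (~: I) v.
have h_cont : continuous h by move=> v; apply: (@cvgB _ _ _ (nbhs v)); exact: g_cont.
have [v vl vi0] := hypH_limit (Hi i0).
have [w wl wj0] := hypH_limit (Hi j0).
have hv : h v < 0.
  rewrite /h (g_eq0 I v).2; last by exists i0.
  rewrite sub0r oppr_lt0 lt0r g_ge0 andbT; apply/eqP => /g_eq0[j].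
  rewrite inE => jI vj; have := limit_neq0 _ vl.
  by rewrite (sep _ _ _ i0I jI vi0 vj) eqxx.
have hw : 0 < h w.
  rewrite /h (g_eq0 (~: I) w).2; last by exists j0; rewrite ?inE.
  rewrite subr0 lt0r g_ge0 andbT; apply/eqP => /g_eq0[i iI wi].
  have := limit_neq0 _ wl.
  by rewrite (sep _ _ _ iI j0I wi wj0) eqxx.
have nhv : frequently (fun t => 0 <= t /\ h (y t) < 0).
  apply: (limit_pt_frequently (K := [set v | h v < 0]) vl).
  have nb : nbhs (h v) [set z | z < 0].
    by apply: open_nbhs_nbhs; split; [exact: open_lt|exact: hv].
  exact: (h_cont v _ nb).
have nhw : frequently (fun t => 0 <= t /\ 0 < h (y t)).
  apply: (limit_pt_frequently (K := [set v | 0 < h v]) wl).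
  have nb : nbhs (h w) [set z | 0 < z].
    by apply: open_nbhs_nbhs; split; [exact: open_gt|exact: hw].
  exact: (h_cont w _ nb).
have zeros : frequently [set t | h (y t) = 0].
  move=> T; have [t1 Tt1 [t10 h1]] := nhv T; have [t2 Tt2 [t20 h2]] := nhw T.
  have hy_cont a b : 0 <= a -> {within `[a, b], continuous (h \o y)}.
    move=> a0; apply: within_continuous_comp; first by move=> ? _; exact: h_cont.
    exact: continuous_traj.
  have [t12|t21] := leP t1 t2.
    have [|c] := IVT (v := 0) t12 (hy_cont t1 t2 t10).
      by rewrite /= ge_min le_max (ltW h1) (ltW h2) orbT.
    rewrite in_itv /= => /andP[tc _] hc; exists c => //; exact: le_trans tc.
  have [|c] := IVT (v := 0) (ltW t21) (hy_cont t2 t1 t20).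
    by rewrite /= ge_min le_max (ltW h1) (ltW h2) orbT.
  rewrite in_itv /= => /andP[tc _] hc; exists c => //; exact: le_trans tc.
have [z zl zc] := frequently_cluster zeros.
have zF := within_frequently zeros.
have hz : h z = 0.
  apply: (cluster_cvg_image _ zc); first exact: h_cont.
  apply/cvgrPdist_lt => e e0.
  by apply: (@filterE _ (pinfty_nbhs R)) => t /= ht; rewrite ht subrr normr0.
have [k zk] := limit_pt_isometric nchaos zl.
have gIJ : g I z = g (~: I) z by apply/eqP; rewrite -subr_eq0; apply/eqP.
have gI0 : g I z = 0.
  have [kI|kI] := boolP (k \in I); first by apply/g_eq0; exists k.
  by rewrite gIJ; apply/g_eq0; exists k; rewrite ?inE.
have [i iI zi] := (g_eq0 _ _).1 gI0.
have [j] := (g_eq0 _ _).1 (etrans (esym gIJ) gI0); rewrite inE => jI zj.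
by have := limit_neq0 _ zl; rewrite (sep _ _ _ iI jI zi zj) eqxx.
Qed.

End LimitSet.

(** * Overlapping subspaces and the dimension conditions *)

Section Overlaps.
Variables (K : fieldType) (vT : vectType K) (p : nat) (V : 'I_p -> {vspace vT}).

(** Connectedness of the graph on the indices in which i and j are joined when V i
    and V j share a nonzero vector, in the form given by cuts. *)
Definition overlap_connected := forall (I : {set 'I_p}) i0 j0,
  i0 \in I -> j0 \notin I ->
  exists i j, [/\ i \in I, j \notin I & (V i :&: V j)%VS != 0%VS].

Hypothesis Vconn : overlap_connected.

(** Across the cut between I and its complement some V j overlaps the sum over I, so
    adding j to I raises the dimension of the sum by less than dim (V j). *)
Lemma overlap_connected_grow k : (k < p)%N -> exists I : {set 'I_p},
  #|I| = k.+1 /\ (\dim (\sum_(i in I) V i) + k <= \sum_(i in I) \dim (V i))%N.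
Proof.
elim: k => [p0|k IH kp].
  by exists [set Ordinal p0]%SET; rewrite cards1 !big_set1 addn0.
have [I [cI dI]] := IH (ltnW kp).
have [i0 i0I] : exists i, i \in I by apply/card_gt0P; rewrite cI.
have [j0 j0I] : exists j, j \notin I.
  have : (0 < #|~: I|)%N by have := cardsC I; rewrite card_ord cI; lia.
  by move=> /card_gt0P[j]; rewrite inE; exists j.
have [i [j [iI jI ij]]] := Vconn i0I j0I.
exists (j |: I)%SET; rewrite cardsU1 jI cI; split => //.
rewrite !big_setU1//=; set U := (\sum_(k in I) V k)%VS in dI *.
have jU : (0 < \dim (V j :&: U))%N.
  rewrite lt0n dimv_eq0; apply: contraNneq ij => jU0.
  rewrite -subv0 -jU0 capvC capvS//.
  by rewrite /U (bigD1 i)//= addvSl.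
rewrite -(leq_add2r (\dim (V j :&: U))) addnAC dimv_sum_cap -!addnA leq_add2l.
by rewrite addnS -addn1 leq_add.
Qed.

Lemma overlap_connected_dim_sum : (0 < p)%N ->
  (\dim (\sum_i V i)%VS + p.-1 <= \sum_i \dim (V i))%N.
Proof.
move=> p0; have [I [cI]] : exists I : {set 'I_p}, #|I| = p.-1.+1 /\
    (\dim (\sum_(i in I) V i) + p.-1 <= \sum_(i in I) \dim (V i))%N.
  by apply: overlap_connected_grow; rewrite prednK.
suff -> : I = [set: 'I_p]%SET.
  rewrite (eq_bigl xpredT) => [|i]; last by rewrite inE.
  by rewrite [in leqRHS](eq_bigl xpredT) => [|i]; rewrite ?inE.
by apply/eqP; rewrite eqEcard finset.subsetT cardsT card_ord cI /= leqSpred.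
Qed.

End Overlaps.

Section IsometricSubspaces.
Context {R : realType} {d p : nat}.
Variable B : 'I_p -> 'M[R]_d.
Hypothesis hB : forall i, nsd ((B i)^T + B i).
Hypothesis hV : \bigcap_i Vset B i = [set 0].

Lemma mem_Vsp i v : (v \in Vsp B i) = true <-> Vset B i v.
Proof.
have <- : [set` Vsp B i] v = Vset B i v; last by [].
by rewrite /Vsp (isometric_set_vspan (hB i)).
Qed.

Lemma Vset_common_eq0 v : (forall i, Vset B i v) -> v = 0.
Proof.
move=> vV; have : (\bigcap_i Vset B i) v by move=> i _; exact: vV.
by rewrite hV.
Qed.

(** Condition 1 contradicts the existence of nonzero vectors in each V_i. Conditions
    2 and 3 contradict connectedness at the cut isolating one index: a line that
    meets V_k outside 0 is contained in V_k, and for two modes the only overlap is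
    the common intersection. Condition 4 contradicts the dimension count. *)
Lemma dim_condition_separates : dim_condition B ->
  (forall i, exists2 v, v != 0 & Vset B i v) ->
  ~ overlap_connected (Vsp B).
Proof.
move=> dimB Vn0 Vconn.
have dim0 i : \dim (Vsp B i) <> 0%N.
  move=> /eqP; rewrite dimv_eq0 => /eqP Vi0; have [v v0 /mem_Vsp] := Vn0 i.
  by rewrite Vi0 memv0 (negbTE v0).
case: dimB => [[i /dim0//]|[i [Vi1 Vij]]|p2|[p2 dimB]].
- have [j ji] : exists j, j != i.
    apply: contrapT => /forallNP nj; apply: (dim0 i).
    suff -> : Vsp B i = 0%VS by rewrite dimv0.
    apply/eqP; rewrite -subv0; apply/subvP => v /mem_Vsp vi; rewrite memv0.
    apply/eqP/Vset_common_eq0 => j.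
    by have /negP/negPn/eqP -> := nj j.
  have [|i' [k []]] := Vconn [set i]%SET i j (set11 i); first by rewrite inE.
  rewrite !inE => /eqP -> ki ik; apply: (Vij k ki) => v /mem_Vsp vi; apply/mem_Vsp.
  suff /eqP e : (Vsp B i :&: Vsp B k)%VS == Vsp B i.
    by move: vi; rewrite -e memv_cap => /andP[].
  by rewrite eqEdim capvSl Vi1 lt0n dimv_eq0.
- have p0 : (0 < p)%N by rewrite p2.
  have p1 : (1 < p)%N by rewrite p2.
  have [||i [j [iI jI ij]]] := Vconn [set Ordinal p0]%SET (Ordinal p0) (Ordinal p1).
  + by rewrite inE.
  + by rewrite inE.
  case/negP: ij; rewrite -subv0; apply/subvP => v.
  rewrite memv_cap memv0 => /andP[/mem_Vsp vi /mem_Vsp vj].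
  apply/eqP/Vset_common_eq0 => k; suff [->|->] : k = i \/ k = j by [].
  move: iI jI; rewrite !inE => /eqP -> /eqP j0.
  have [k0|k0] := eqVneq (val k) 0%N; first by left; apply: val_inj.
  have j0' : val j <> 0%N by move=> e; apply: j0; apply: val_inj.
  right; apply: val_inj => /=.
  by have := ltn_ord k; have := ltn_ord j; move: k0 j0' => /=; lia.
- have p0 : (0 < p)%N by lia.
  have := overlap_connected_dim_sum Vconn p0.
  move: dimB; rewrite -(big_morph Posz PoszD (erefl _)); lia.
Qed.

(** If no V_i is 0, then all are lines in the plane. They are not all equal, as their
    intersection is 0, so p >= 2; for p > 2 their sum has dimension 2, while the
    bound in the fourth condition is p - p + 1. *)
Lemma plane_dim_condition : d = 2%N -> (forall i, Vset B i <> setT) -> dim_condition B.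
Proof.
move=> d2 VT.
have [[i Vi0]|/forallNP Vn0] := pselect (exists i, \dim (Vsp B i) = 0%N).
  by apply: Or41; exists i.
have fd : \dim {:'cV[R]_d} = 2%N by rewrite dimvf dim_matrix d2.
have Vi1 i : \dim (Vsp B i) = 1%N.
  have : \dim (Vsp B i) <> 2%N.
    move=> Vi2; apply: (VT i); apply/seteqP; split => // v _; apply/mem_Vsp.
    suff /eqP -> : Vsp B i == fullv by exact: memvf.
    by rewrite eqEdim subvf Vi2 fd.
  have := dimvS (subvf (Vsp B i)); rewrite fd => Vi2.
  by have := Vn0 i; lia.
have nz : exists v : 'cV[R]_d, v != 0.
  have i0 : 'I_d by rewrite d2; exact: ord0.
  exists (const_mx 1); apply/eqP => /colP /(_ i0); rewrite !mxE => /eqP.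
  by rewrite oner_eq0.
have [i0 _] : exists i : 'I_p, true.
  apply: contrapT => /forallNP np; have [v /eqP v0] := nz.
  by apply: v0; apply: Vset_common_eq0 => i; case: (np i).
have p0 : (0 < p)%N by exact: leq_ltn_trans (ltn_ord i0).
have all_equal : ~ (forall i, (Vsp B i0 <= Vsp B i)%VS).
  move=> Vle; apply: (Vn0 i0); apply/eqP; rewrite dimv_eq0 -subv0.
  apply/subvP => v vi0; rewrite memv0; apply/eqP/Vset_common_eq0 => i.
  by apply/mem_Vsp; exact: (subvP (Vle i)).
have [p2|p2] := ltnP 2 p; last first.
  have [p2'|p1] := eqVneq p 2%N; first exact: Or43.
  case: all_equal => i; suff -> : i = i0 by [].
  by apply: val_inj => /=; have := ltn_ord i; have := ltn_ord i0; lia.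
apply: Or44; split => //.
have -> : (\sum_i (\dim (Vsp B i))%:Z)%R = p%:Z.
  rewrite (eq_bigr (fun=> 1)); last by move=> i _; rewrite Vi1.
  by rewrite sumr_const card_ord natz.
suff : (1 < \dim (\sum_i Vsp B i)%VS)%N by lia.
rewrite ltnNge; apply/negP => dimS; apply: all_equal => i.
have VS j : (Vsp B j <= \sum_i Vsp B i)%VS by exact: sumv_sup (subvv _).
have eqS j : Vsp B j = (\sum_i Vsp B i)%VS by apply/eqP; rewrite eqEdim VS Vi1.
by rewrite (eqS i0) (eqS i).
Qed.

End IsometricSubspaces.

Section Convergence.
Context {R : realType} {d p : nat}.
Variables (B : 'I_p -> 'M[R]_d) (u : input R p).
Hypothesis hB : forall i, nsd ((B i)^T + B i).
Hypothesis hV : \bigcap_i Vset B i = [set 0].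

Lemma normsq_traj_limit_eq0 (x : 'cV[R]_d) (r : R) : regular u -> dim_condition B ->
  normsq (traj B u x t) @[t --> +oo] --> r -> r = 0.
Proof.
move=> ureg dimB xr; apply/eqP/negPn/negP => r0.
apply: (dim_condition_separates hB hV dimB).
  move=> i; have [w wl wi] := hypH_limit hB xr (ureg.2 i); exists w => //.
  by apply: contra_neq r0 => w0; rewrite -(limit_pt_normsq xr wl) w0 normsq0.
move=> I i0 j0 i0I j0I.
have [i [j [iI jI [v v0 [vi vj]]]]] := limit_set_connected hB xr ureg r0 i0I j0I.
exists i, j; split => //; apply: contraNneq v0 => Vij.
rewrite -memv0 -Vij memv_cap; apply/andP.
by split; apply/(mem_Vsp hB).
Qed.

Lemma regular_asymptotically_stable :
  regular u -> dim_condition B -> asymptotically_stable B u.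
Proof.
move=> ureg dimB x; have [r xr] := normsq_traj_cvg u x hB.
have r0 := normsq_traj_limit_eq0 ureg dimB xr; rewrite r0 in xr.
apply/cvgr0Pnorm_lt => e e0.
have [M [Mr hM]] := (cvgrPdist_lt _ _).1 xr _ (exprn_gt0 2 e0).
exists M; split => // t /hM; rewrite sub0r normrN ger0_norm ?normsq_ge0// => h.
rewrite (le_lt_trans (mx_norm_le_normsq _))// -(ger0_norm (ltW e0)) -sqrtr_sqr.
by rewrite ltr_sqrt ?exprn_gt0.
Qed.

(** A square root S of the limit satisfies S^T S = S S = 0, so it kills every
    vector. *)
Lemma asymptotically_stable_Slim : asymptotically_stable B u -> Slim B u = 0.
Proof.
move=> ust.
have Phi0 : Phi B u t @[t --> +oo] --> (0 : 'M[R]_d).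
  apply: cvg_mxP => i j; rewrite mxE.
  have h : (Phi B u t *m delta_mx j (0 : 'I_1)) i 0 @[t --> +oo]
      --> (0 : 'cV[R]_d) i 0 by exact: cvg_mx_entry (ust _).
  rewrite [X in _ --> X]mxE in h.
  suff <- : (fun t => (Phi B u t *m delta_mx j (0 : 'I_1)) i 0) =
            (fun t => Phi B u t i j) by [].
  by apply/funext => t; rewrite -colE mxE.
have PhiTPhi0 : (Phi B u t)^T *m Phi B u t @[t --> +oo] --> (0 : 'M[R]_d).
  rewrite -(mul0mx d (0 : 'M[R]_d)); apply: cvg_mulmx => //.
  apply: cvg_mxP => i j; rewrite mxE; under eq_fun do rewrite mxE.
  have h : Phi B u t j i @[t --> +oo] --> (0 : 'M[R]_d) j i.
    exact: cvg_mx_entry Phi0.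
  by rewrite [X in _ --> X]mxE in h.
rewrite /Slim; case: xgetP => [S _ /= [ST Spsd PS]|/(_ 0) []].
  have SS : S *m S = 0 by exact: (cvg_unique _ PS PhiTPhi0).
  apply/matrixP => i j; rewrite mxE.
  have : S *m delta_mx j 0 = 0 :> 'cV[R]_d.
    by apply: normsq_eq0; rewrite /normsq trmx_mul ST mulmxA -(mulmxA _ S S) SS mulmx0 mul0mx mxE.
  by rewrite -colE => /colP /(_ i); rewrite !mxE.
split; first by rewrite trmx0.
  by move=> x; rewrite mulmx0 mul0mx mxE.
by rewrite mulmx0.
Qed.

End Convergence.

Theorem theorem4 (R : realType) (d p : nat) (B : 'I_p -> 'M[R]_d)
    (hB : forall i, nsd ((B i)^T + B i))
    (hV : \bigcap_i Vset B i = [set 0]) :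
  (forall u : input R p, regular u -> dim_condition B ->
     Slim B u = 0 /\ asymptotically_stable B u) /\
  (d = 2%N -> (forall i, Vset B i <> setT) -> dim_condition B).
Proof.
split; last exact: plane_dim_condition.
move=> u ureg dimB; have ust := regular_asymptotically_stable hB hV ureg dimB.
by split => //; exact: asymptotically_stable_Slim.
Qed.
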